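(* Let $\mathcal{X}$ be a finite set with $|\mathcal{X}|=r\ge 2$, let $\mathcal{Z}=\{0,1,\ldots,k-1\}$ with $2\le k\le r$, and let $f:\mathcal{X}\to\mathcal{Z}$ be a given mapping with $|f^{-1}(0)|\ge|f^{-1}(1)|\ge\cdots\ge|f^{-1}(k-1)|$. Let $\frac1k<\rho\le1$, and let $l=l(\rho)\in\{1,\ldots,k-1\}$ be determined by $\frac1{l+1}<\rho\le\frac1l$. For appropriate locally identical $\rho$-QRs $W^{lo}=W^{lo}(\rho)$, it holds that for the (restricted) class $\mathcal{S}_n$ of smooth estimators for the querier $$\inf_{\widehat P_n\in\mathcal{S}_n}\ \sup_{P_X}\ \pi_n\big(\rho,W^{lo},P_X,\widehat P_n\big)\ \ge\ \big(\omega(\rho)+\Lambda_n(\rho)\big)\lambda_n(\rho)=\Big(\log\sum_{j=0}^{l-1}|f^{-1}(j)|+\Lambda_n(\rho)\Big)\lambda_n(\rho)$$ for all $n$ large enough, where $\Lambda_n(\rho)$ and $\lambda_n(\rho)$ are as follows, with $\hat\gamma_n$ and $c_n$ the parameters of the smooth estimators. If $l\le\lfloor k/2\rfloor$, write $m=\lfloor k/l\rfloor\, l$, $b=l\,\frac{1-l\rho}{m-l}$, $S_0=\sum_{j=0}^{l-1}|f^{-1}(j)|$, $S_1=\sum_{j=l}^{m-1}|f^{-1}(j)|$ and $$\mu_n=\frac{\min\big\{\frac{\lceil n b\rceil}{n},\ l\rho\big\}-b}{l\rho-b};$$ then $$\Lambda_n(\rho)=\begin{cases}\log\Big(1+\frac{S_1}{e\,S_0}\,\mu_n\Big)-\frac{\hat\gamma_n}{c_n},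 & S_1\le S_0,\\[4pt] \mu_n\log\Big(\frac{S_1}{S_0}\Big)-\frac{\hat\gamma_n}{c_n}, & S_1>S_0.\end{cases}$$ If $l>\lfloor k/2\rfloor$, then $$\Lambda_n(\rho)=\log\left(1+\frac{|f^{-1}(l)|}{e\sum_{j=0}^{l-1}|f^{-1}(j)|}\cdot\frac{\frac{\lceil n(1-l\rho)\rceil}{n}-(1-l\rho)}{l\rho}\right)-\frac{\hat\gamma_n}{c_n}.$$ For all $l=l(\rho)$, $$\lambda_n(\rho)=1-\frac{3\,e^{\left(\frac{4\left(\lfloor k/l\rfloor+k-\lfloor k/l\rfloor l-1\right)\sqrt{\zeta}}{5\sqrt e}\right)}}{n^{\zeta}}\qquad\text{with }\zeta>1.$$ Furthermore, $$\lim_{n}\Lambda_n(\rho)=0,\qquad \lim_{n}\lambda_n(\rho)=1,\qquad \tfrac1k<\rho\le 1,$$ and $$\lim_{n}\ \inf_{\widehat P_n\in\mathcal{S}_n}\ \sup_{P_X}\ \pi_n\big(\rho,W^{lo},P_X,\widehat P_n\big)\ \ge\ \omega(\rho)=\log\sum_{j=0}^{l-1}|f^{-1}(j)|,\qquad \tfrac1{l+1}<\rho\le\tfrac1l,\ 1\le l\le k-1.$$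
   Context: All logarithms $\log$ are to base 2; $e$ is Euler's number. $D(\cdot\|\cdot)$ is Kullback–Leibler divergence. $\Delta_r$ denotes the simplex of all probability mass functions (pmfs) on $\mathcal{X}$, and $\sup_{P_X}$ is over $P_X\in\Delta_r$. The variational distance between pmfs $P,Q$ on a common finite set is $\mathrm{var}(P,Q)=\sum_x|P(x)-Q(x)|$. For $z\in\mathcal{Z}$, $f^{-1}(z)=\{x\in\mathcal{X}:f(x)=z\}$. A user generates i.i.d. data $X_1,\ldots,X_n$ with pmf $P_X$ and a querier observes query responses $Z_1,\ldots,Z_n$. A $\rho$-QR is a stochastic matrix $W:\mathcal{X}\to\mathcal{Z}$ with $W(f(x)|x)\ge\rho$ for all $x\in\mathcal{X}$. It is locally identical if for each $j\in\mathcal{Z}$ the rows $W(\cdot|x)$ are identical for all $x\in f^{-1}(j)$. For $P_X\in\Delta_r$, $(P_XW)(z)=\sum_xP_X(x)W(z|x)$. For an estimator $\widehat P_n:\mathcal{Z}^n\to\Delta_r$, $$\pi_n(\rho,W,P_X,\widehat P_n)=\mathbb{E}\big[D(P_X\|\widehat P_n(Z^n))\big],\qquad Z_1,\ldots,Z_n\text{ i.i.d. with pmf }P_XW.$$ The function $\omega$ is defined by $\omega(\rho)=\log r$ for $0\le\rho\le\frac1k$, and $\omega(\rho)=\max_{\mathcal{Z}_l\subset\mathcal{Z},\,|\mathcal{Z}_l|=l}\log\sum_{j\in\mathcal{Z}_l}|f^{-1}(j)|$ for $\frac1{l+1}<\rho\le\frac1l$, $1\le l\le k-1$ (which equals $\log\sum_{j=0}^{l-1}|f^{-1}(j)|$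 under the assumed ordering). Smooth estimators. Consider any partition of $\mathcal{Z}$ into $k'\le k$ atoms and label the atoms by $\mathcal{Z}'=\mathcal{Z}'(k')=\{0,1,\ldots,k'-1\}$. Let $\mathcal{Q}'^{(n)}$ be the set of all $n$-types on $\mathcal{Z}'$ (empirical pmfs of sequences in $\mathcal{Z}'^n$). A smooth estimator $\widehat P_n:\mathcal{Q}'^{(n)}\to\Delta_r$, $n\ge1$, is such that for some $\gamma_n>0$, $\hat\gamma_n>0$ and $c_n>0$, $n\ge1$, with $\lim_n\gamma_n=0$, $\lim_n\hat\gamma_n=0$, $\lim_nc_n=0$ and $\hat\gamma_n/c_n=o(1/n)$ (so that $\lim_n\hat\gamma_n/c_n=0$), the following hold: (1) for $Q'^{(n)}\ne Q''^{(n)}$ in $\mathcal{Q}'^{(n)}$ with $\mathrm{var}(Q'^{(n)},Q''^{(n)})\le\gamma_n$, one has $\mathrm{var}\big(\widehat P_n(Q'^{(n)}),\widehat P_n(Q''^{(n)})\big)\le\hat\gamma_n$; and (2) for each $Q'^{(n)}\in\mathcal{Q}'^{(n)}$, $\widehat P_n(Q'^{(n)})(x)\ge c_n$ for all $x\in\mathcal{X}$. The class of all such estimators is denoted $\mathcal{S}_n=\mathcal{S}_n(k')$, $n\ge1$. Such an estimator is regarded as an estimator on $\mathcal{Z}^n$ by evaluating it, at $z^n\in\mathcal{Z}^n$, on the type of the sequence in $\mathcal{Z}'^n$ obtained by replacing each $z_t$ by the label of its atom.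
   Formalization: The final limit of inf sup π_n need not exist for smooth estimators (γ_n may alternate between 1/n and 1/log n, e.g. k=2, fibers of size 2, ρ=1), so the last inequality is stated for the lower limit (liminf) in n, which covers every case where the limit exists. *)

(* Defs.v *)
(* Everything is over an arbitrary [R : realType].  The data alphabet is a
   finType [X] (so r is [#|X|]), the query alphabet is ['I_k], and pmfs on a
   finite set are real functions satisfying [is_pmf]. *)
From HB Require Import structures.
From mathcomp Require Import all_boot all_order all_algebra.
From mathcomp Require Import all_classical all_reals all_analysis.
Set Implicit Arguments.
Unset Strict Implicit.
Unset Printing Implicit Defensive.
Import Order.TTheory GRing.Theory Num.Theory.
Import numFieldNormedType.Exports.
Local Open Scope classical_set_scope.
Local Open Scope ring_scope.

Definition log2 {R : realType} (x : R) : R := ln x / ln 2.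

Definition is_pmf {R : realType} {T : finType} (p : T -> R) : Prop :=
  (forall t, 0 <= p t) /\ \sum_(t : T) p t = 1.

Definition vardist {R : realType} {T : finType} (p q : T -> R) : R :=
  \sum_(t : T) `|p t - q t|.

(* Kullback-Leibler divergence in bits; +oo when [p] is not absolutely
   continuous w.r.t. [q].  Terms with [p t = 0] vanish. *)
Definition KL {R : realType} {T : finType} (p q : T -> R) : \bar R :=
  if [exists t, (p t != 0) && (q t == 0)] then +oo%E
  else (\sum_(t : T) p t * log2 (p t / q t))%:E.

(* f^{-1}(j); empty when [k <= j]. *)
Definition fiber {X : finType} {k : nat} (f : X -> 'I_k) (j : nat) : {set X} :=
  [set x | f x == j :> nat].

(* |f^{-1}(i)| + ... + |f^{-1}(j-1)| *)
Definition fiber_sum {X : finType} {k : nat} (f : X -> 'I_k) (i j : nat) : nat :=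
  (\sum_(i <= t < j) #|fiber f t|)%N.

Definition rho_QR {R : realType} {X : finType} {k : nat} (f : X -> 'I_k)
    (rho : R) (W : X -> 'I_k -> R) : Prop :=
  (forall x, is_pmf (W x)) /\ (forall x, rho <= W x (f x)).

Definition locally_identical {R : realType} {X : finType} {k : nat}
    (f : X -> 'I_k) (W : X -> 'I_k -> R) : Prop :=
  forall j : 'I_k, {in fiber f j &, forall x x', W x =1 W x'}.

Definition output_pmf {R : realType} {X : finType} {k : nat}
    (P : X -> R) (W : X -> 'I_k -> R) (z : 'I_k) : R :=
  \sum_(x : X) P x * W x z.

(* E[D(P || Phat(Z^n))] for Z_1, ..., Z_n i.i.d. with pmf PW; the convention
   0 * +oo = 0 discards the sequences of probability zero. *)
Definition dist_privacy {R : realType} {X : finType} {k n : nat}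
    (W : X -> 'I_k -> R) (P : X -> R)
    (Phat : n.-tuple 'I_k -> X -> R) : \bar R :=
  (\sum_(z : n.-tuple 'I_k)
     (\prod_(t < n) output_pmf P W (tnth z t))%:E * KL P (Phat z))%E.

(* For each rho > 1/k the maximum is over the subsets of the query alphabet
   whose cardinality l satisfies 1/(l+1) < rho <= 1/l; l = 0 is ruled out for
   rho > 0 since 0^-1 = 0.  The logarithms are nonnegative, so 0 is a harmless default. *)
Definition omega {R : realType} {X : finType} {k : nat} (f : X -> 'I_k)
    (rho : R) : R :=
  if rho <= k%:R^-1 then log2 #|X|%:R
  else \big[Num.max/0]_(Zl : {set 'I_k} |
              (#|Zl|.+1%:R)^-1 < rho <= #|Zl|%:R^-1)
         log2 (\sum_(j in Zl) #|fiber f j|)%N%:R.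

(* A partition of 'I_k into k' nonempty atoms labelled by 'I_k', given by the
   map sending an element to the label of its atom (hence k' <= k). *)
Definition labelled_partition {k k' : nat} (phi : 'I_k -> 'I_k') : Prop :=
  forall a : 'I_k', exists j : 'I_k, phi j = a.

Definition empirical_pmf (R : realType) {k' n : nat} (s : n.-tuple 'I_k') :
    {ffun 'I_k' -> R} :=
  [ffun a => (count_mem a s)%:R / n%:R].

Definition is_ntype {R : realType} {k' : nat} (n : nat)
    (Q : {ffun 'I_k' -> R}) : Prop :=
  exists s : n.-tuple 'I_k', Q = empirical_pmf R s.

(* The sequences are indexed from 1; their values at 0 are irrelevant. *)
Definition smooth_params {R : realType} (gamma hgamma c : nat -> R) : Prop :=
  [/\ forall n, (0 < n)%N -> [/\ 0 < gamma n, 0 < hgamma n & 0 < c n],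
      [/\ gamma n @[n --> \oo] --> (0 : R),
          hgamma n @[n --> \oo] --> (0 : R) &
          c n @[n --> \oo] --> (0 : R)] &
      (fun n => hgamma n / c n : R^o) =o_\oo (fun n => n%:R^-1 : R^o)].

(* An estimator is a total function on {ffun 'I_k' -> R}, of which only the
   values at n-types matter. *)
Definition smooth_estimator {R : realType} {X : finType} {k' : nat} (n : nat)
    (gamma_n hgamma_n c_n : R)
    (Phat : {ffun 'I_k' -> R} -> X -> R) : Prop :=
  [/\ forall Q, is_ntype n Q -> is_pmf (Phat Q),
      forall Q Q', is_ntype n Q -> is_ntype n Q' -> Q <> Q' ->
        vardist Q Q' <= gamma_n -> vardist (Phat Q) (Phat Q') <= hgamma_n &
      forall Q, is_ntype n Q -> forall x, c_n <= Phat Q x].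

Definition on_sequences {R : realType} {X : finType} {k k' : nat}
    (phi : 'I_k -> 'I_k') (n : nat) (Phat : {ffun 'I_k' -> R} -> X -> R) :
    n.-tuple 'I_k -> X -> R :=
  fun z => Phat (empirical_pmf R (map_tuple phi z)).

(* inf over S_n(k') of sup over P_X; it is +oo when the class is empty, which
   can only happen for finitely many n as c_n tends to 0. *)
Definition smooth_minimax {R : realType} {X : finType} {k k' : nat}
    (W : X -> 'I_k -> R) (phi : 'I_k -> 'I_k') (gamma hgamma c : nat -> R)
    (n : nat) : \bar R :=
  ereal_inf
    [set ereal_sup [set dist_privacy W P (@on_sequences R X k k' phi n Phat)
                   | P in [set P : X -> R | is_pmf P]]
    | Phat in [set Phat : {ffun 'I_k' -> R} -> X -> R
              | smooth_estimator n (gamma n) (hgamma n) (c n) Phat]].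

Definition ceil_frac {R : realType} (n : nat) (x : R) : R :=
  (Num.ceil (n%:R * x))%:~R / n%:R.

Definition mu_seq {R : realType} (k l : nat) (rho : R) (n : nat) : R :=
  let m : nat := (k %/ l * l)%N in
  let b : R := l%:R * ((1 - l%:R * rho) / (m%:R - l%:R)) in
  (Num.min (ceil_frac n b) (l%:R * rho) - b) / (l%:R * rho - b).

Definition Lambda_seq {R : realType} {X : finType} {k : nat} (f : X -> 'I_k)
    (l : nat) (rho : R) (hgamma c : nat -> R) (n : nat) : R :=
  let m := (k %/ l * l)%N in
  let e : R := expR 1 in
  let S0 := fiber_sum f 0 l in
  let S1 := fiber_sum f l m in
  if (l <= k %/ 2)%N then
    if (S1 <= S0)%N then
      log2 (1 + S1%:R / (e * S0%:R) * mu_seq k l rho n) - hgamma n / c n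
    else
      mu_seq k l rho n * log2 (S1%:R / S0%:R) - hgamma n / c n
  else
    log2 (1 + #|fiber f l|%:R / (e * S0%:R)
              * ((ceil_frac n (1 - l%:R * rho) - (1 - l%:R * rho))
                 / (l%:R * rho)))
    - hgamma n / c n.

Definition lambda_seq {R : realType} (k l : nat) (zeta : R) (n : nat) : R :=
  let q : R := (k %/ l)%:R in
  1 - 3 * expR (4 * (q + k%:R - q * l%:R - 1) * Num.sqrt zeta
                / (5 * Num.sqrt (expR 1)))
      / (n%:R `^ zeta).

(* Main.v *)
(* The QR sends every x with f x < l to one and the same output law (rho on each
   of 0, ..., l - 1 and the rest on l) and reveals f x otherwise.  All inputs in
   the first l fibers are thus indistinguishable, and averaging over the point
   masses there gives minimax >= log2 S0 for any positive estimator, smooth or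
   not.

   The correction Lambda_n is at most K / n, and it is nonpositive when
   l rho = 1 or the l-th fiber is empty.  Otherwise the minimax exceeds log2 S0
   by an amount of order 1 / sqrt n, which is more than needed: an estimator
   giving some fixed y in the l-th fiber mass at least K / n on average loses at
   a point mass, and one giving it less loses at the mixture
   (1 - e) delta_x + e delta_y with e = 1 / sqrt n.  Indeed the likelihood ratio
   of the n responses has bounded third moment, so y still gets average mass
   o(1 / sqrt n) under the mixture, while its weight there is e.
   Hence (omega + Lambda_n) lambda_n <= omega + K / n <= minimax for n large. *)
Require Import Defs.
From mathcomp Require Import all_boot all_order all_algebra.
From mathcomp Require Import all_classical all_reals all_analysis.
From mathcomp Require Import ring lra.
Import Order.TTheory GRing.Theory Num.Theory.
Import numFieldNormedType.Exports.
Local Open Scope classical_set_scope.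
Local Open Scope ring_scope.

(** * Averages and change of measure *)

Section FiniteSums.
Context {R : realType}.
Implicit Types I J X : finType.

Lemma exists_ge_mean X (A : {set X}) (F : X -> R) (T : R) :
  (0 < #|A|)%N -> #|A|%:R * T <= \sum_(x in A) F x ->
  exists2 x, x \in A & T <= F x.
Proof.
move=> A0 hT.
case: (boolP [exists x in A, T <= F x]) => [/exists_inP[x xA Tx]|]; first by exists x.
rewrite negb_exists_in => /forall_inP hlt.
suff : \sum_(x in A) F x < #|A|%:R * T by rewrite ltNge hT.
rewrite mulr_natl -sumr_const.
have /card_gt0P[x0 x0A] := A0.
rewrite (bigD1 x0) //= [X in _ < X](bigD1 x0) //=.
apply: ltr_leD; first by rewrite ltNge hlt.
by apply: ler_sum => x /andP[xA _]; rewrite leNgt; apply/negP => /ltW h; have := hlt x xA; rewrite h.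
Qed.

Lemma sum_tuple_prod J (n : nat) (w : J -> R) :
  \sum_(z : n.-tuple J) \prod_(t < n) w (tnth z t) = (\sum_j w j) ^+ n.
Proof.
rewrite -[in RHS](card_ord n) -prodr_const bigA_distr_bigA /=.
rewrite (reindex (@tuple_of_finfun J n)); last first.
  by apply: onW_bij; exists (@finfun_of_tuple J n);
    [exact: tuple_of_finfunK | exact: finfun_of_tupleK].
apply: eq_bigr => g _; apply: eq_bigr => t _.
by rewrite tnth_mktuple.
Qed.

(* Where the likelihood ratio [L] exceeds [C], it is at most [L ^ 3 / C ^ 2];
   elsewhere it is at most [C]. *)
Lemma change_of_measure I (U L b : I -> R) (C E : R) :
  (forall i, 0 <= U i) -> (forall i, 0 <= L i) ->
  (forall i, 0 <= b i <= 1) -> 0 < C ->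
  \sum_i U i * L i ^+ 3 <= E ->
  \sum_i U i * L i * b i <= C * (\sum_i U i * b i) + E / C ^+ 2.
Proof.
move=> U0 L0 b01 C0 hE.
have C20 : 0 < C ^+ 2 by rewrite exprn_gt0.
apply: (@le_trans _ _ (C * (\sum_i U i * b i) + (\sum_i U i * L i ^+ 3) / C ^+ 2)).
  rewrite mulr_sumr mulr_suml -big_split /=; apply: ler_sum => i _.
  rewrite -mulrA [C * _]mulrCA -mulrA -mulrDr ler_wpM2l //.
  have /andP[b0 b1] := b01 i; have Li := L0 i.
  have [LC|/ltW CL] := leP (L i) C.
    by rewrite ler_wpDr ?ler_wpM2r // divr_ge0 ?exprn_ge0 // ltW.
  apply: (@le_trans _ _ (L i ^+ 3 / C ^+ 2)).
    rewrite ler_pdivlMr // (@le_trans _ _ (L i * C ^+ 2)) //.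
      by rewrite ler_wpM2r ?(ltW C20) // ler_piMr.
    by rewrite [leRHS]exprS ler_wpM2l // ler_pXn2r // nnegrE ltW.
  by rewrite ler_wpDl // mulr_ge0 ?(ltW C0).
by rewrite lerD2l ler_pM2r ?invr_gt0.
Qed.

Lemma ln_le_sub1 (x : R) : 0 < x -> ln x <= x - 1.
Proof.
move=> x0; have := expR_ge1Dx (ln x); rewrite lnK ?posrE //; lra.
Qed.

End FiniteSums.

(** * Divergence at point masses and two-point mixtures *)

Section Privacy.
Context {R : realType} {X : finType} {k n : nat}.
Implicit Types (A : {set X}) (W : X -> 'I_k -> R) (q : n.-tuple 'I_k -> X -> R).

(** Stated for arbitrary weights, since products of likelihood ratios are needed besides products of
    pmfs. *)
Definition seq_prob (w : 'I_k -> R) (z : n.-tuple 'I_k) : R :=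
  \prod_(t < n) w (tnth z t).

Definition point_mass (x : X) : X -> R := fun t => (t == x)%:R.

Definition mixture (e : R) (x y : X) : X -> R :=
  fun t => (1 - e) * point_mass x t + e * point_mass y t.

Lemma seq_prob_ge0 (w : 'I_k -> R) z :
  (forall j, 0 <= w j) -> 0 <= seq_prob w z.
Proof. by move=> w0; apply: prodr_ge0. Qed.

Lemma sum_seq_prob (w : 'I_k -> R) : is_pmf w -> \sum_z seq_prob w z = 1.
Proof. by case=> _ w1; rewrite sum_tuple_prod w1 expr1n. Qed.

Lemma sum_point_mass (x : X) (F : X -> R) : \sum_t point_mass x t * F t = F x.
Proof.
rewrite (bigD1 x) //= big1 ?addr0 => [|t /negPf tx].
  by rewrite /point_mass eqxx mul1r.
by rewrite /point_mass tx mul0r.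
Qed.

Lemma sum_mixture e x y (F : X -> R) :
  \sum_t mixture e x y t * F t = (1 - e) * F x + e * F y.
Proof.
rewrite -(sum_point_mass x F) -(sum_point_mass y F) !mulr_sumr -big_split /=.
by apply: eq_bigr => t _; rewrite mulrDl !mulrA.
Qed.

Lemma point_mass_pmf x : is_pmf (point_mass x).
Proof.
split=> [t|]; first exact: ler0n.
by rewrite -[RHS](sum_point_mass x (fun=> 1)); apply: eq_bigr => t _; rewrite mulr1.
Qed.

Lemma mixture_pmf e x y : 0 <= e <= 1 -> is_pmf (mixture e x y).
Proof.
move=> /andP[e0 e1]; split=> [t|].
  by rewrite addr_ge0 // mulr_ge0 // ?subr_ge0 //; apply: ler0n.
transitivity (\sum_t mixture e x y t * 1).
  by apply: eq_bigr => t _; rewrite mulr1.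
by rewrite sum_mixture !mulr1 subrK.
Qed.

(** Strict positivity of [q] excludes the infinite branch of [KL], leaving a real sum. *)
Lemma dist_privacy_pos W (P : X -> R) q : (forall z x, 0 < q z x) ->
  dist_privacy W P q =
  (\sum_z seq_prob (output_pmf P W) z * \sum_x P x * log2 (P x / q z x))%:E.
Proof.
move=> q0; rewrite /dist_privacy -sumEFin; apply: eq_bigr => z _.
rewrite /KL ifF; first by rewrite EFinM.
by apply/existsP => -[x]; rewrite (gt_eqF (q0 z x)) andbF.
Qed.

Lemma ln2_gt0 : 0 < ln 2 :> R.
Proof. by rewrite ln_gt0 ?ltr1n. Qed.

Lemma point_mass_privacy W x q : (forall z x', 0 < q z x') ->
  dist_privacy W (point_mass x) q =
  (\sum_z seq_prob (W x) z * (- ln (q z x) / ln 2))%:E.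
Proof.
move=> q0; rewrite dist_privacy_pos //; congr EFin; apply: eq_bigr => z _.
congr (_ * _).
  by apply: eq_bigr => t _; rewrite /output_pmf sum_point_mass.
by rewrite sum_point_mass /point_mass eqxx div1r /log2 lnV ?posrE // mulNr.
Qed.

Lemma mixture_privacy W e x y q : (forall z x', 0 < q z x') -> x != y ->
  dist_privacy W (mixture e x y) q =
  (\sum_z seq_prob (fun j => (1 - e) * W x j + e * W y j) z *
     (((1 - e) * ln ((1 - e) / q z x) + e * ln (e / q z y)) / ln 2))%:E.
Proof.
move=> q0 xy; rewrite dist_privacy_pos //; congr EFin; apply: eq_bigr => z _.
congr (_ * _).
  by apply: eq_bigr => t _; rewrite /output_pmf sum_mixture.
have yx : (y == x) = false by rewrite eq_sym (negPf xy).
rewrite sum_mixture /mixture /point_mass !eqxx (negPf xy) yx.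
by rewrite !mulr0 !mulr1 addr0 add0r /log2 [RHS]mulrDl !mulrA.
Qed.

(** Exchanging the two sums yields a single [x] that serves for the average over all [z]. *)
Lemma exists_ge_weighted_mean A (U : n.-tuple 'I_k -> R)
    (G : n.-tuple 'I_k -> X -> R) (T : n.-tuple 'I_k -> R) :
  (0 < #|A|)%N -> (forall z, 0 <= U z) ->
  (forall z, #|A|%:R * T z <= \sum_(x in A) G z x) ->
  exists2 x, x \in A & \sum_z U z * T z <= \sum_z U z * G z x.
Proof.
move=> A0 U0 hT; apply: (@exists_ge_mean R X A (fun x => \sum_z U z * G z x)) => //.
rewrite exchange_big /= mulr_sumr; apply: ler_sum => z _.
by rewrite mulrCA -mulr_sumr ler_wpM2l.
Qed.

(** Convexity of [- ln]: the tangent line at [p = 1 / c]. *)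
Lemma neg_ln_ge_tangent (c p : R) : 0 < c -> 0 < p -> ln c + 1 - c * p <= - ln p.
Proof.
move=> c0 p0; have := ln_le_sub1 _ (mulr_gt0 c0 p0).
by rewrite lnM ?posrE //; lra.
Qed.

(** Inputs in [A] share the response law [u], so their losses can be averaged under it. The tangents
    at [1 / #|A|] average to [ln #|A|] plus the mass that [q] wastes outside [A]. *)
Lemma point_mass_lower_bound W A (u : 'I_k -> R) q :
  (0 < #|A|)%N -> {in A, forall x, W x =1 u} -> is_pmf u ->
  (forall z x, 0 < q z x) ->
  exists2 x, x \in A &
    (((ln #|A|%:R + \sum_z seq_prob u z * (1 - \sum_(x in A) q z x)) / ln 2)%R%:E
    <= dist_privacy W (point_mass x) q)%E.
Proof.
move=> A0 WA upmf q0; have NA0 : 0 < #|A|%:R :> R by rewrite ltr0n.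
have [||x xA hx] := @exists_ge_weighted_mean A (seq_prob u)
  (fun z x => - ln (q z x)) (fun z => ln #|A|%:R + (1 - \sum_(x in A) q z x)) A0.
- by move=> z; apply: seq_prob_ge0; case: upmf.
- move=> z; apply: (@le_trans _ _
      (\sum_(x in A) (ln #|A|%:R + 1 - #|A|%:R * q z x))).
    by rewrite sumrB sumr_const -mulr_sumr -[(_ + _) *+ _]mulr_natl addrA mulrBr.
  by apply: ler_sum => x _; exact: neg_ln_ge_tangent.
exists x => //; rewrite point_mass_privacy // lee_fin.
under [leRHS]eq_bigr do rewrite mulrA.
rewrite -mulr_suml ler_pM2r ?invr_gt0 ?ln2_gt0 //.
move: hx; under eq_bigr do rewrite mulrDr.
rewrite big_split /= -mulr_suml sum_seq_prob // mul1r => /le_trans; apply.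
apply: ler_sum => z _; rewrite (_ : seq_prob (W x) z = seq_prob u z) //.
by apply: eq_bigr => t _; exact: WA.
Qed.

(* The tangent line to [ln] at [q z y] is taken at [e / (expR 1 * #|A|)], the
   predictive mass of [y] under the prior weight [1 / (expR 1 * #|A|)] for the
   contamination; this weight maximises the resulting bound. *)
Lemma mixture_lower_bound W A (u v : 'I_k -> R) y q (e : R) :
  (0 < #|A|)%N -> {in A, forall x, W x =1 u} -> W y =1 v ->
  is_pmf u -> is_pmf v -> y \notin A -> 0 < e < 1 ->
  (forall z, is_pmf (q z)) -> (forall z x, 0 < q z x) ->
  exists2 x, x \in A &
    (((ln #|A|%:R + e - expR 1 * #|A|%:R *
        \sum_z seq_prob (fun j => (1 - e) * u j + e * v j) z * q z y) / ln 2)%R%:E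
    <= dist_privacy W (mixture e x y) q)%E.
Proof.
move=> A0 WA Wy upmf vpmf yA /andP[e0 e1] qpmf q0.
have NA0 : 0 < #|A|%:R :> R by rewrite ltr0n.
have uv0 j : 0 <= (1 - e) * u j + e * v j.
  have [u0 _] := upmf; have [v0 _] := vpmf.
  by rewrite addr_ge0 ?mulr_ge0 ?subr_ge0 ?(ltW e0) ?(ltW e1).
have uv_pmf : is_pmf (fun j => (1 - e) * u j + e * v j).
  split=> //; rewrite big_split /= -!mulr_sumr.
  by have [_ ->] := upmf; have [_ ->] := vpmf; rewrite !mulr1 subrK.
set w := fun j => _ in uv_pmf *.
have [||x xA hx] := @exists_ge_weighted_mean A (seq_prob w)
  (fun z x => (1 - e) * ln ((1 - e) / q z x) + e * ln (e / q z y))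
  (fun z => ln #|A|%:R + e - expR 1 * #|A|%:R * q z y) A0.
- by move=> z; apply: seq_prob_ge0.
(* The inner bracket collects the terms free of [x]; those in [q z x] sum to at most
   [(1 - e) * #|A|], because [q z] has mass at most 1 on [A]. *)
- move=> z; apply: (@le_trans _ _ (\sum_(x in A)
      ((- e + (1 - e) * (ln #|A|%:R + 1) + e * (ln #|A|%:R + 2)
         - expR 1 * #|A|%:R * q z y) - (1 - e) * #|A|%:R * q z x))).
    rewrite sumrB sumr_const -mulr_sumr -[(_ - _) *+ _]mulr_natl.
    have : \sum_(x in A) q z x <= 1.
      have [q0' <-] := qpmf z; rewrite [leRHS](bigID (mem A)) /= lerDl.
      by apply: sumr_ge0.
    have e10 : 0 <= 1 - e by rewrite subr_ge0 ltW.
    move: (\sum_(x in A) _) (ln _) (q z y) => s L p s1.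
    have : 0 <= (1 - e) * #|A|%:R * (1 - s).
      by rewrite !mulr_ge0 ?subr_ge0 // ltW.
    by move: (#|A|%:R) (expR 1) => N E; nra.
  apply: ler_sum => x _.
  have e10 : 0 < 1 - e by rewrite subr_gt0.
  rewrite !ln_div ?posrE //.
  have h1 := neg_ln_ge_tangent _ _ NA0 (q0 z x).
  have cc : 0 < expR 1 * #|A|%:R / e by rewrite divr_gt0 ?mulr_gt0 ?expR_gt0.
  have h2 := neg_ln_ge_tangent _ _ cc (q0 z y).
  (* The [- e * ln e] coming from this tangent cancels the [e * ln e] of the divergence. *)
  rewrite ln_div ?lnM ?expRK ?posrE ?mulr_gt0 ?expR_gt0 // in h2.
  have h3 : - e <= (1 - e) * ln (1 - e).
    have hi : 0 < (1 - e)^-1 by rewrite invr_gt0.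
    have := ln_le_sub1 _ hi; rewrite lnV ?posrE // => h.
    rewrite -lerN2 opprK -mulrN.
    apply: (@le_trans _ _ ((1 - e) * ((1 - e)^-1 - 1))); first by rewrite ler_pM2l.
    by rewrite mulrBr mulfV ?gt_eqF // mulr1; lra.
  have h2' := ler_wpM2l (ltW e0) h2.
  have h1' := ler_wpM2l (ltW e10) h1.
  have E2 : e * (expR 1 * #|A|%:R / e * q z y) = expR 1 * #|A|%:R * q z y.
    by field; rewrite gt_eqF.
  move: h1' h2' h3 E2; move: (expR 1 * #|A|%:R / e * q z y) (expR 1 * #|A|%:R * q z y).
  move: (q z x) (ln #|A|%:R) (ln (q z x)) (ln (q z y)) (ln e) (ln (1 - e)).
  by clear; move=> *; nra.
exists x => //.
have xy : x != y by apply: contraNneq yA => <-.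
rewrite mixture_privacy // lee_fin.
under [leRHS]eq_bigr do rewrite mulrA.
rewrite -mulr_suml ler_pM2r ?invr_gt0 ?ln2_gt0 //.
move: hx; under eq_bigr do rewrite mulrBr mulrCA.
rewrite sumrB /= -mulr_suml -mulr_sumr sum_seq_prob // mul1r => /le_trans; apply.
apply: ler_sum => z _.
rewrite (_ : seq_prob _ z = seq_prob w z) //.
by apply: eq_bigr => t _; rewrite WA // Wy.
Qed.

End Privacy.

(** * The locally identical QR *)

(** Smooth estimators take values at least [c n > 0], so a bound over strictly positive estimators
    suffices. [P] may depend on [q], since the supremum stands inside the infimum. *)
Lemma smooth_minimax_ge {R : realType} {X : finType} {k k' : nat}
    (W : X -> 'I_k -> R) (phi : 'I_k -> 'I_k') (gamma hgamma c : nat -> R)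
    (n : nat) (T : R) :
  0 < c n ->
  (forall q : n.-tuple 'I_k -> X -> R,
     (forall z, is_pmf (q z)) -> (forall z x, 0 < q z x) ->
     exists2 P, is_pmf P & (T%:E <= dist_privacy W P q)%E) ->
  (T%:E <= smooth_minimax W phi gamma hgamma c n)%E.
Proof.
move=> c0 hT; apply: le_ereal_inf_tmp => _ [Phat [Ppmf _ Pc] <-].
have tz (z : n.-tuple _) : @is_ntype R k' n (empirical_pmf R (map_tuple phi z)) by exists (map_tuple phi z).
have [||P Ppmf' hP] := hT (@on_sequences R X k k' phi n Phat).
- by move=> z; exact: Ppmf.
- by move=> z x; apply: lt_le_trans c0 _; exact: Pc.
by apply: le_trans hP _; apply: ereal_sup_ubound; exists P.
Qed.

(** The left side is the third moment of a likelihood ratio equal to [1 - e + e / a] with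
    probability [a] and to [1 - e] otherwise. Its mean is 1, which removes the term of order [e]. *)
Lemma third_moment_bound {R : realType} (a e : R) : 0 < a < 1 -> 0 <= e <= 1 ->
  (1 - a) * (1 - e) ^+ 3 + a * (1 - e + e / a) ^+ 3 <=
  1 + (3 + 3 * (a^-1 - 1) ^+ 2 + (a^-1 - 1) ^+ 3) * e ^+ 2.
Proof.
move=> /andP[a0 a1] /andP[e0 e1].
have ai : a * a^-1 = 1 by rewrite mulfV // gt_eqF.
set d := a^-1 - 1.
have d0 : 0 <= d by rewrite subr_ge0 invf_ge1 // ltW.
have ad : a * d = 1 - a by rewrite mulrBr ai mulr1.
have -> : 1 - e + e / a = 1 + e * d by rewrite /d; ring.
have -> : (1 - a) * (1 - e) ^+ 3 + a * (1 + e * d) ^+ 3 =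
  1 + 3 * e * (a * d - (1 - a)) + 3 * (1 - a) * e ^+ 2 - (1 - a) * e ^+ 3
    + a * (3 * d ^+ 2 * e ^+ 2) + a * (d ^+ 3 * e ^+ 3) by ring.
rewrite ad subrr mulr0 addr0.
have h1 : (1 - a) * e ^+ 2 <= e ^+ 2 by rewrite ler_piMl ?exprn_ge0 //; lra.
have h2 : 0 <= (1 - a) * e ^+ 3 by rewrite mulr_ge0 ?exprn_ge0 //; lra.
have h3 : a * (3 * d ^+ 2 * e ^+ 2) <= 3 * d ^+ 2 * e ^+ 2.
  by rewrite ler_piMl ?(ltW a1) // !mulr_ge0 ?exprn_ge0.
have h4 : a * (d ^+ 3 * e ^+ 3) <= d ^+ 3 * e ^+ 2.
  apply: (@le_trans _ _ (d ^+ 3 * e ^+ 3)).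
    by rewrite ler_piMl ?(ltW a1) // mulr_ge0 ?exprn_ge0.
  by rewrite ler_wpM2l ?exprn_ge0 // exprS ler_piMl ?exprn_ge0.
lra.
Qed.

Section LocallyIdenticalQR.
Context {R : realType} {X : finType} {k : nat}.
Variables (f : X -> 'I_k) (rho : R) (l : nat).
Hypotheses (lk : (l < k)%N) (rho0 : 0 <= rho) (lrho1 : l%:R * rho <= 1).

Definition lo_row (z : 'I_k) : R :=
  if (z < l)%N then rho else if z == l :> nat then 1 - l%:R * rho else 0.

Definition lo_QR (x : X) (z : 'I_k) : R :=
  if (f x < l)%N then lo_row z else (z == f x)%:R.

Definition low_fibers : {set X} := [set x | (f x < l)%N].

(** Only functions of whether [z = l] get averaged: constants for the normalisation, cubes of
    likelihood ratios for the third moment. *)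
Lemma sum_lo_row (a b : R) :
  \sum_z lo_row z * (if z == l :> nat then a else b) =
  l%:R * rho * b + (1 - l%:R * rho) * a.
Proof.
rewrite (bigD1 (Ordinal lk)) //= /lo_row /= ltnn eqxx addrC; congr (_ + _).
rewrite (bigID (fun z : 'I_k => (z < l)%N)) /= [X in _ + X]big1 ?addr0; last first.
  move=> z /andP[zl /negPf zl']; rewrite zl' ifF ?mul0r //.
  by apply/negbTE.
transitivity (\sum_(z < k | (z < l)%N) rho * b).
  apply: eq_big => [z|z /andP[zl zl']].
    by case: ltnP => // h; rewrite ?andbF // andbT -val_eqE /= neq_ltn h.
  by rewrite zl' (ltn_eqF zl').
rewrite -(big_ord_widen k (fun=> rho * b) (ltnW lk)) sumr_const card_ord.
by rewrite -[(rho * b) *+ l]mulr_natl mulrA.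
Qed.

Lemma lo_row_ge0 z : 0 <= lo_row z.
Proof. by rewrite /lo_row; case: ifP => // _; case: ifP => //; rewrite subr_ge0. Qed.

Lemma lo_row_pmf : is_pmf lo_row.
Proof.
split; first exact: lo_row_ge0.
transitivity (\sum_z lo_row z * (if z == l :> nat then 1 else 1)).
  by apply: eq_bigr => z _; rewrite if_same mulr1.
by rewrite sum_lo_row !mulr1 addrC subrK.
Qed.

Lemma unit_row_pmf (j : 'I_k) : is_pmf (fun z : 'I_k => (z == j)%:R : R).
Proof.
split=> [z|]; first exact: ler0n.
by rewrite (bigD1 j) //= eqxx big1 ?addr0 // => i /negPf ->.
Qed.

Lemma lo_QR_is_rho_QR : rho <= 1 -> rho_QR f rho lo_QR.
Proof.
move=> rho1; split=> x; rewrite /lo_QR; case: ltnP => h.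
- exact: lo_row_pmf.
- exact: unit_row_pmf.
- by rewrite /lo_row h.
- by rewrite eqxx.
Qed.

Lemma lo_QR_locally_identical : locally_identical f lo_QR.
Proof.
move=> j x x'; rewrite !inE => /eqP xj /eqP x'j z.
by rewrite /lo_QR (_ : f x = f x') //; apply: val_inj; rewrite /= xj x'j.
Qed.

Lemma lo_QR_low : {in low_fibers, forall x, lo_QR x =1 lo_row}.
Proof. by move=> x; rewrite inE /lo_QR => ->. Qed.


Lemma lo_QR_baseline n (q : n.-tuple 'I_k -> X -> R) :
  (0 < #|low_fibers|)%N -> (forall z, is_pmf (q z)) -> (forall z x, 0 < q z x) ->
  exists2 P, is_pmf P & ((log2 #|low_fibers|%:R)%:E <= dist_privacy lo_QR P q)%E.
Proof.
move=> A0 qpmf q0.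
have [x xA hx] := point_mass_lower_bound _ _ _ _ A0 lo_QR_low lo_row_pmf q0.
exists (point_mass x); first exact: point_mass_pmf.
apply: le_trans hx; rewrite lee_fin /log2 ler_pM2r ?invr_gt0 ?ln2_gt0 //.
rewrite lerDl; apply: sumr_ge0 => z _; rewrite mulr_ge0 ?seq_prob_ge0 //.
  exact: lo_row_ge0.
have [qz0 <-] := qpmf z; rewrite subr_ge0 [leRHS](bigID (mem low_fibers)) /= lerDl.
by apply: sumr_ge0.
Qed.

(** * Excess over the baseline by contamination with a point of the [l]-th fiber *)

Section Contamination.
Variables (y : X) (fy : f y = l :> nat) (lrho : l%:R * rho < 1) (lrho0 : 0 < l%:R * rho).
(** [a] is the probability of response [l] from an input in the first [l] fibers; [moment_const] is
    to bound [(1 + c / n) ^ n], with [c] the coefficient in [third_moment_bound]. *)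
Let a : R := 1 - l%:R * rho.
Let moment_const : R := expR (3 + 3 * (a^-1 - 1) ^+ 2 + (a^-1 - 1) ^+ 3).

(** Density of the contaminated row with respect to [lo_row]. Above [l] both rows vanish and [1 - e]
    is a default value. *)
Definition likelihood_ratio (e : R) (z : 'I_k) : R :=
  if z == l :> nat then 1 - e + e / a else 1 - e.

Let a01 : 0 < a < 1.
Proof. by rewrite /a; move: lrho lrho0 => *; lra. Qed.

Lemma likelihood_ratio_ge0 e z : 0 <= e <= 1 -> 0 <= likelihood_ratio e z.
Proof.
move=> /andP[e0 e1]; have /andP[a0 _] := a01.
have h : 0 <= e / a by rewrite divr_ge0 // ltW.
by rewrite /likelihood_ratio; case: ifP => _; lra.
Qed.

Lemma contaminated_row e z :
  (1 - e) * lo_row z + e * lo_QR y z = lo_row z * likelihood_ratio e z.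
Proof.
have /andP[a0 _] := a01.
rewrite /lo_QR fy ltnn -val_eqE /= fy /lo_row /likelihood_ratio.
case: ltngtP => h; rewrite ?mulr0 ?mul0r ?addr0 ?mul0r 1?mulrC //.
by rewrite -/a (_ : true%:R = 1 :> R) //; field; rewrite gt_eqF.
Qed.

(** With [e = 1 / sqrt n] the one-letter moment is at most [1 + c / n], whose [n]-th power is at
    most [expR c] uniformly in [n]. *)
Lemma third_moment_seq n : (0 < n)%N ->
  \sum_(z : n.-tuple 'I_k) seq_prob lo_row z *
     seq_prob (likelihood_ratio (Num.sqrt n%:R)^-1) z ^+ 3 <= moment_const.
Proof.
move=> n0; set e := (Num.sqrt _)^-1.
have nR0 : 0 < n%:R :> R by rewrite ltr0n.
have e2 : e ^+ 2 = n%:R^-1 by rewrite /e exprVn sqr_sqrtr // ltW.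
have e0 : 0 <= e by rewrite invr_ge0 sqrtr_ge0.
have e1 : e <= 1.
  by rewrite -(@expr_le1 _ 2) // e2 invf_le1 // ler1n.
under eq_bigr do rewrite /seq_prob -prodrXl -big_split /=.
rewrite (@sum_tuple_prod R 'I_k n (fun j => lo_row j * likelihood_ratio e j ^+ 3)).
set c := 3 + 3 * (a^-1 - 1) ^+ 2 + (a^-1 - 1) ^+ 3.
apply: (@le_trans _ _ ((1 + c * e ^+ 2) ^+ n)); last first.
  rewrite e2 /moment_const -/c.
  have -> : expR c = expR (c / n%:R) ^+ n.
    by rewrite -expRM_natl mulrCA mulfV ?mulr1 // gt_eqF.
  have /andP[a0 a1] := a01.
  have c0 : 0 <= c.
    have d0 : 0 <= a^-1 - 1 by rewrite subr_ge0 invf_ge1 // ltW.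
    by rewrite /c !addr_ge0 ?mulr_ge0 ?exprn_ge0.
  rewrite lerXn2r ?nnegrE ?expR_ge0 ?expR_ge1Dx //.
  by rewrite addr_ge0 // divr_ge0 // ltW.
have hE : \sum_j lo_row j * likelihood_ratio e j ^+ 3 =
   (1 - a) * (1 - e) ^+ 3 + a * (1 - e + e / a) ^+ 3.
  have -> : 1 - a = l%:R * rho by rewrite /a; ring.
  rewrite -[X in _ + X * _]/(1 - l%:R * rho) -sum_lo_row.
  by apply: eq_bigr => z _; rewrite /likelihood_ratio; case: ifP.
have le3 : \sum_j lo_row j * likelihood_ratio e j ^+ 3 <= 1 + c * e ^+ 2.
  by rewrite hE; apply: third_moment_bound; rewrite ?a01 ?e0.
have ge3 : 0 <= \sum_j lo_row j * likelihood_ratio e j ^+ 3.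
  apply: sumr_ge0 => j _; rewrite mulr_ge0 ?lo_row_ge0 ?exprn_ge0 //.
  by apply: likelihood_ratio_ge0; rewrite e0.
by rewrite lerXn2r // nnegrE // (le_trans ge3).
Qed.

(** The threshold on [n] is uniform in [q], so that the bound survives the infimum over
    estimators. *)
Lemma lo_QR_excess (K : R) : 0 <= K -> (0 < #|low_fibers|)%N ->
  \forall n \near \oo, forall q : n.-tuple 'I_k -> X -> R,
    (forall z, is_pmf (q z)) -> (forall z x, 0 < q z x) ->
    exists2 P, is_pmf P &
      ((log2 #|low_fibers|%:R + K / n%:R)%:E <= dist_privacy lo_QR P q)%E.
Proof.
move=> K0 A0; set A := low_fibers in A0 *.
have yA : y \notin A by rewrite inE fy ltnn.
have NA0 : 0 < #|A|%:R :> R by rewrite ltr0n.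
(* [K'] is [K] in natural-logarithm units; [D] is the price per unit of mass given to [y] in the
   mixture bound. *)
set K' := K * ln 2; have K'0 : 0 <= K' by rewrite mulr_ge0 // ltW // ln2_gt0.
pose D : R := expR 1 * #|A|%:R; have D0 : 0 < D by rewrite mulr_gt0 ?expR_gt0.
(* [delta] makes [D * delta * K' <= 1 / 4]; the three terms of [S] ensure [s^-1 < 1],
   [K' / n <= s^-1 / 2] and a third-moment remainder of at most [s^-1 / 4]. *)
set delta := (4 * D * (K' + 1))^-1.
have delta0 : 0 < delta by rewrite invr_gt0 !mulr_gt0 //; lra.
set M := moment_const; have M0 : 0 < M by exact: expR_gt0.
pose S : R := 2 + 2 * K' + 4 * D * M / delta ^+ 2.
near=> n => q qpmf q0.
have t0 : 0 <= 4 * D * M / delta ^+ 2.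
  by rewrite !mulr_ge0 ?invr_ge0 ?exprn_ge0 ?(ltW D0) ?(ltW M0) ?(ltW delta0).
have S0 : 2 <= S by rewrite /S; lra.
have nS : S ^+ 2 <= n%:R by near: n; exact: nbhs_infty_ger.
have nR0 : 0 < n%:R :> R by apply: lt_le_trans nS; rewrite exprn_gt0 //; lra.
have n0 : (0 < n)%N by rewrite -(ltr0n R).
set s : R := Num.sqrt n%:R.
have s2 : s ^+ 2 = n%:R by rewrite sqr_sqrtr // ltW.
have sS : S <= s by rewrite /s -(@ger0_norm _ S) -?sqrtr_sqr ?ler_wsqrtr //; lra.
have s0 : 0 < s by lra.
have e01 : 0 < s^-1 < 1 by rewrite invr_gt0 s0 invf_lt1 //; lra.
have logE (t : R) : log2 #|A|%:R + K / n%:R <= t / ln 2 <-> ln #|A|%:R + K' / n%:R <= t.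
  rewrite ler_pdivlMr ?ln2_gt0 // mulrDl /log2 divfK ?gt_eqF ?ln2_gt0 //.
  by rewrite /K' mulrAC.
set U := @seq_prob R k n lo_row.
have U0 z : 0 <= U z by apply: seq_prob_ge0; exact: lo_row_ge0.
(* Dichotomy on the average mass of [y] under [lo_row]. If it is large, it is lost to [A], as [y]
   lies outside [A], and a point mass suffices. *)
have [tK|tK] := leP (K' / n%:R) (\sum_z U z * q z y).
  have [x xA hx] := point_mass_lower_bound _ _ _ _ A0 lo_QR_low lo_row_pmf q0.
  exists (point_mass x); first exact: point_mass_pmf.
  apply: le_trans hx; rewrite lee_fin; apply/logE; rewrite lerD2l.
  apply: le_trans tK _; apply: ler_sum => z _; rewrite ler_wpM2l //.
  have [qz0 <-] := qpmf z; rewrite lerBrDr [leRHS](bigID (mem A)) /= [leLHS]addrC lerD2l.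
  by rewrite (bigD1 y) //= lerDl; apply: sumr_ge0.
have lo_y_pmf : is_pmf (lo_QR y).
  rewrite (_ : lo_QR y = fun z : 'I_k => (z == f y)%:R); first exact: unit_row_pmf.
  by apply/funext => z; rewrite /lo_QR fy ltnn.
(* Otherwise the mixture gains [s^-1] and pays [D] times the average mass of [y] under the
   contaminated law. *)
have [x xA hx] := @mixture_lower_bound R X k n lo_QR A lo_row (lo_QR y) y q s^-1
  A0 lo_QR_low (fun=> erefl) lo_row_pmf lo_y_pmf yA e01 qpmf q0.
exists (mixture s^-1 x y).
  by apply: mixture_pmf; case/andP: e01 => h1 h2; rewrite !ltW.
apply: le_trans hx; rewrite lee_fin; apply/logE; rewrite -addrA lerD2l -/D.
set L := @seq_prob R k n (likelihood_ratio s^-1).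
have hV : \sum_z seq_prob (fun j => (1 - s^-1) * lo_row j + s^-1 * lo_QR y j) z * q z y =
  \sum_z U z * L z * q z y.
  apply: eq_bigr => z _; congr (_ * _); rewrite /U /L /seq_prob -big_split /=.
  by apply: eq_bigr => t _; rewrite contaminated_row.
have L0 z : 0 <= L z.
  apply: seq_prob_ge0 => j; apply: likelihood_ratio_ge0.
  by case/andP: e01 => h1 h2; rewrite !ltW.
have q01 z : 0 <= q z y <= 1.
  have [qz0 <-] := qpmf z; rewrite qz0 (bigD1 y) //= lerDl; exact: sumr_ge0.
(* Likelihood ratios are cut at [delta * s]: below the cut the mass of [y] grows at most by that
   factor, above it the third moment leaves [O(1 / n)]. *)
have ds0 : 0 < delta * s by rewrite mulr_gt0.
have := @change_of_measure R _ U L (fun z => q z y) _ M U0 L0 q01 ds0 (third_moment_seq n n0).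
rewrite -hV; set V := \sum_z _ * _; set t := \sum_z _ in tK *.
move=> hVt.
have h1 : D * (delta * s * t) <= s^-1 / 4.
  apply: (@le_trans _ _ (D * (delta * s * (K' / n%:R)))).
    by rewrite !ler_wpM2l ?(ltW D0) ?(ltW ds0) ?(ltW tK).
  have -> : D * (delta * s * (K' / n%:R)) = K' / (K' + 1) * (s^-1 / 4).
    by rewrite -s2 /delta; field; rewrite !gt_eqF //; lra.
  rewrite ler_piMl //; first by rewrite divr_ge0 // invr_ge0 ltW.
  by rewrite ler_pdivrMr; lra.
have h2 : D * (M / (delta * s) ^+ 2) <= s^-1 / 4.
  have -> : D * (M / (delta * s) ^+ 2) = (4 * D * M / delta ^+ 2) * (s^-1 * s^-1 / 4).
    by field; rewrite !gt_eqF.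
  have : 4 * D * M / delta ^+ 2 <= s by move: sS; rewrite /S; lra.
  have p : 0 <= s^-1 * s^-1 / 4 by rewrite divr_ge0 ?mulr_ge0 // invr_ge0 ltW.
  move=> /(ler_wpM2r p) /le_trans; apply.
  by rewrite !mulrA divff ?mul1r // gt_eqF.
have h3 : K' / n%:R <= s^-1 / 2.
  rewrite -s2 ler_pdivrMr ?exprn_gt0 //.
  have -> : s^-1 / 2 * s ^+ 2 = s / 2 by field; rewrite gt_eqF.
  by move: sS; rewrite /S; lra.
have h4 := ler_wpM2l (ltW D0) hVt.
by move: h4; rewrite mulrDr; lra.
Unshelve. all: by end_near.
Qed.

End Contamination.
End LocallyIdenticalQR.

(** * The rate function and the correction terms *)

Definition low_indices (k l : nat) : {set 'I_k} := [set j : 'I_k | (j < l)%N].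

Section FiberSums.
Context {X : finType} {k : nat}.
Variable f : X -> 'I_k.

Lemma card_low_fibers (l : nat) : #|low_fibers f l| = fiber_sum f 0 l.
Proof.
elim: l => [|l IH].
  by rewrite /fiber_sum big_geq //;
    apply/eqP; rewrite cards_eq0 -finset.subset0; apply/fintype.subsetP => x;
    rewrite inE.
rewrite /fiber_sum big_nat_recr //= -/(fiber_sum f 0 l) -IH.
rewrite (_ : low_fibers f l.+1 = low_fibers f l :|: fiber f l).
  rewrite cardsU (_ : _ :&: _ = finset.set0) ?cards0 ?subn0 //.
  by apply/setP => x; rewrite !inE; case: ltngtP.
by apply/setP => x; rewrite !inE ltnS leq_eqVlt orbC.
Qed.

Hypothesis hf : forall i j : 'I_k, (i <= j)%N -> (#|fiber f j| <= #|fiber f i|)%N.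

Lemma fiber_sum_low (l : nat) : (l <= k)%N ->
  fiber_sum f 0 l = (\sum_(j in low_indices k l) #|fiber f j|)%N.
Proof.
move=> lk; rewrite /fiber_sum big_mkord (big_ord_widen k (fun t => #|fiber f t|) lk).
by apply: eq_bigl => j; rewrite inE.
Qed.

Lemma card_low (l : nat) : (l <= k)%N -> #|low_indices k l| = l.
Proof.
move=> lk; rewrite -sum1_card -[RHS](card_ord l) -sum1_card.
by rewrite (big_ord_widen k (fun=> 1%N) lk); apply: eq_bigl => j; rewrite inE.
Qed.

(** Exchange argument: the two set differences between [Z] and the first [l] indices are
    equinumerous, and [#|fiber f l|] separates their fiber sizes. *)
Lemma sum_fiber_le_low (l : nat) (Z : {set 'I_k}) : (l < k)%N -> #|Z| = l ->
  (\sum_(j in Z) #|fiber f j| <= fiber_sum f 0 l)%N.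
Proof.
move=> lk Zl; have lk' := ltnW lk; rewrite fiber_sum_low //.
set L := low_indices k l; have cL : #|L| = l by exact: card_low.
rewrite (big_setID L) [leqRHS](big_setID Z) /= [L :&: Z]finset.setIC leq_add2l.
have cD : #|Z :\: L| = #|L :\: Z| by rewrite !cardsD finset.setIC Zl cL.
apply: (@leq_trans (#|L :\: Z| * #|fiber f l|)).
  rewrite -cD -sum_nat_const; apply: leq_sum => j.
  rewrite !inE -leqNgt => /andP[lj _]; exact: (hf (Ordinal lk)).
rewrite -sum_nat_const; apply: leq_sum => j.
rewrite !inE => /andP[_ jl]; exact: (hf j (Ordinal lk) (ltnW jl)).
Qed.

Lemma fiber_sum_gt0 (l : nat) : (0 < #|X|)%N -> (0 < l)%N -> (0 < fiber_sum f 0 l)%N.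
Proof.
move=> /card_gt0P[x _] l0; rewrite /fiber_sum big_ltn // addn_gt0.
apply/orP; left; have k0 : (0 < k)%N by exact: leq_ltn_trans (ltn_ord (f x)).
apply: leq_trans (hf (Ordinal k0) (f x) (leq0n _)).
by apply/card_gt0P; exists x; rewrite inE.
Qed.

(** Fiber sizes are nonincreasing, so emptiness propagates upwards; from [k] on all fibers are empty
    by definition. *)
Lemma fiber_sum_eq0 (l m : nat) : #|fiber f l| = 0%N -> fiber_sum f l m = 0%N.
Proof.
move=> fl; rewrite /fiber_sum big_nat_cond big1 // => t /andP[/andP[lt _] _].
apply/eqP; rewrite cards_eq0 -finset.subset0; apply/fintype.subsetP => x; rewrite !inE => /eqP fx.
have lk : (l < k)%N by rewrite (leq_ltn_trans lt) // -fx.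
have : (0 < #|fiber f (f x)|)%N by apply/card_gt0P; exists x; rewrite inE.
have h : (#|fiber f (f x)| <= 0)%N.
  by rewrite -[X in (_ <= X)%N]fl; apply: (hf (Ordinal lk)); rewrite /= fx.
by rewrite ltnNge h.
Qed.

End FiberSums.

(** * The value of [omega] under the ordering of the fibers *)

Section Omega.
Context {R : realType}.

Lemma log2_ge0 (x : R) : 1 <= x -> 0 <= log2 x.
Proof. by move=> x1; rewrite divr_ge0 ?ln_ge0 ?ler1n. Qed.

Lemma log2_1Dx_bounds (x : R) : 0 <= x -> 0 <= log2 (1 + x) <= x / ln 2.
Proof.
move=> x0; rewrite log2_ge0 ?lerDl //= ler_pM2r ?invr_gt0 ?ln2_gt0 //.
by apply: le_ln1Dx; lra.
Qed.

(** The intervals [(1 / (l + 1), 1 / l]] are disjoint, so the maximum in [omega] runs over sets of a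
    single cardinality. *)
Lemma reciprocal_interval_inj (rho : R) (l m : nat) :
  (l.+1%:R)^-1 < rho <= l%:R^-1 -> (m.+1%:R)^-1 < rho <= m%:R^-1 -> l = m.
Proof.
suff le a b : (a.+1%:R)^-1 < rho <= a%:R^-1 -> (b.+1%:R)^-1 < rho <= b%:R^-1 -> (a <= b)%N.
  by move=> h h'; apply/eqP; rewrite eqn_leq !le.
move=> /andP[a1 a2] /andP[b1 b2].
have := lt_le_trans b1 a2; case: a {a1 a2} => // a.
by rewrite ltf_pV2 ?posrE ?ltr0n // ltr_nat ltnS.
Qed.

Lemma omega_eq (X : finType) (k : nat) (f : X -> 'I_k) (rho : R) (l : nat) :
  (0 < #|X|)%N -> (0 < l < k)%N ->
  (forall i j : 'I_k, (i <= j)%N -> (#|fiber f j| <= #|fiber f i|)%N) ->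
  k%:R^-1 < rho -> (l.+1%:R)^-1 < rho <= l%:R^-1 ->
  omega f rho = log2 (fiber_sum f 0 l)%:R.
Proof.
move=> X0 /andP[l0 lk] hf krho hl; rewrite /omega leNgt krho /=.
have S0 := fiber_sum_gt0 f hf l X0 l0.
apply/eqP; rewrite eq_le; apply/andP; split.
  apply: bigmax_le; first by rewrite log2_ge0 // ler1n.
  move=> Z hZ; have Zl : #|Z| = l by apply: reciprocal_interval_inj hZ hl.
  have le := sum_fiber_le_low f hf l Z lk Zl.
  rewrite ler_pM2r ?invr_gt0 ?ln2_gt0 //.
  (* If all fibers over [Z] are empty, the convention [ln 0 = 0] applies. *)
  have [->|Z0] := posnP (\sum_(j in Z) #|fiber f j|)%N.
    by rewrite ln0 // ln_ge0 // ler1n.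
  by rewrite ler_ln ?posrE ?ltr0n // ler_nat.
rewrite fiber_sum_low ?(ltnW lk) //.
apply: (@le_bigmax_cond _ _ _ 0 (low_indices k l)
  (fun Z : {set 'I_k} => ((#|Z|.+1)%:R)^-1 < rho <= #|Z|%:R^-1)
  (fun Z : {set 'I_k} => log2 (\sum_(j in Z) #|fiber f j|)%N%:R)).
by rewrite card_low // ltnW.
Qed.

End Omega.

(** * Rates of the correction terms *)

Section Limits.
Context {R : realType}.

Lemma ceil_frac_bounds (n : nat) (x : R) : (0 < n)%N ->
  x <= ceil_frac n x <= x + n%:R^-1.
Proof.
move=> n0; have nR : 0 < n%:R :> R by rewrite ltr0n.
rewrite /ceil_frac ler_pdivlMr // ler_pdivrMr // mulrDl mulVf ?gt_eqF //.
rewrite [x * _]mulrC ceil_ge /=.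
by have := ceilB1_lt (n%:R * x); rewrite intrB; lra.
Qed.

Lemma cvg_of_inv_rate (u : nat -> R) (a C : R) :
  (\forall n \near \oo, `|u n - a| <= C / n%:R) -> u n @[n --> \oo] --> a.
Proof.
move=> uC; apply/cvgrPdist_le => e e0; near=> n.
have n0 : 0 < n%:R :> R by rewrite ltr0n; near: n; exact: nbhs_infty_gt.
rewrite distrC; apply: (@le_trans _ _ (C / n%:R)); first by near: n.
rewrite ler_pdivrMr // mulrC -ler_pdivrMr //.
by near: n; exact: nbhs_infty_ger.
Unshelve. all: by end_near.
Qed.

Lemma limn_einf_ge (u : (\bar R)^nat) (a : \bar R) :
  (\forall n \near \oo, (a <= u n)%E) -> (a <= limn_einf u)%E.
Proof.
move=> [N _ hN]; rewrite limn_einf_lim; apply: lime_ge; first exact: is_cvg_einfs.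
exists N => // n /= Nn; apply: le_ereal_inf_tmp => _ [m /= nm <-].
by apply: hN => /=; exact: leq_trans nm.
Qed.

(** The exponential factor is constant in [n] and [n ^ zeta >= n], so the deviation from 1 is
    [O(1 / n)]. *)
Lemma lambda_seq_bounds (k l : nat) (zeta : R) : 1 < zeta ->
  exists2 C, 0 <= C & forall n, (0 < n)%N ->
    1 - C / n%:R <= lambda_seq k l zeta n <= 1.
Proof.
move=> z1; rewrite /lambda_seq; set C := 3 * expR _.
have C0 : 0 <= C by rewrite mulr_ge0 ?expR_ge0.
exists C => // n n0; rewrite -/C gerBl divr_ge0 ?powR_ge0 // andbT.
have n1 : 1 <= n%:R :> R by rewrite ler1n.
have nz : n%:R <= n%:R `^ zeta by apply: le1r_powR => //; exact: ltW.
by rewrite lerD2l lerN2 ler_wpM2l // lef_pV2 ?posrE //; lra.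
Qed.

(** From [l <= k / 2] follows [m - l >= l], hence [b <= 1 - l rho], which is below [l rho] as
    [rho > 1 / (l + 1) >= 1 / (2 l)]. So the denominator is positive, and rounding up puts at most
    [1 / n] in the numerator. *)
Lemma mu_seq_bounds (k l : nat) (rho : R) : (0 < l)%N -> (l <= k %/ 2)%N ->
  (l.+1%:R)^-1 < rho <= l%:R^-1 ->
  exists2 D, 0 <= D & forall n, (0 < n)%N ->
    0 <= mu_seq k l rho n <= D / n%:R /\ (l%:R * rho = 1 -> mu_seq k l rho n = 0).
Proof.
move=> l0 lk2 /andP[rho1 rho2]; rewrite /mu_seq.
have lR : 1 <= l%:R :> R by rewrite ler1n.
have lrho1 : l%:R * rho <= 1.
  by rewrite mulrC -ler_pdivlMr ?div1r //; lra.
have lrho2 : 1 < (l%:R + 1) * rho.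
  move: rho1; rewrite -[X in X < _]div1r ltr_pdivrMr ?ltr0n //.
  by rewrite -natr1 mulrC.
have q2 : 2 <= (k %/ l)%:R :> R.
  rewrite ler_nat leq_divRL // mulnC.
  by apply: leq_trans (leq_divM k 2); rewrite leq_mul2r lk2 orbT.
set b := l%:R * _.
have b0 : 0 <= b.
  rewrite mulr_ge0 ?divr_ge0 ?subr_ge0 //.
  by rewrite natrM ler_peMl //; lra.
have b1 : b <= 1 - l%:R * rho.
  rewrite /b natrM mulrCA ler_piMr ?subr_ge0 // ler_pdivrMr; nra.
have bl : b < l%:R * rho by nra.
set d := l%:R * rho - b; have d0 : 0 < d by rewrite subr_gt0.
exists d^-1; first by rewrite invr_ge0 ltW.
move=> n n0; have /andP[c1 c2] := ceil_frac_bounds n b n0.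
split.
  apply/andP; split.
    by rewrite divr_ge0 ?(ltW d0) // subr_ge0 le_min c1 ltW.
  rewrite [leRHS]mulrC ler_pM2r ?invr_gt0 // lerBlDr ge_min.
  by apply/orP; left; lra.
move=> lr1; have -> : b = 0 by rewrite /b lr1 subrr mul0r mulr0.
by rewrite /ceil_frac mulr0 ceil0 mul0r lr1 minElt ltr01 subrr mul0r.
Qed.

Lemma Lambda_seq_bounds (X : finType) (k : nat) (f : X -> 'I_k) (l : nat)
    (rho : R) (hgamma c : nat -> R) :
  (0 < l)%N -> (0 < fiber_sum f 0 l)%N ->
  (forall i j : 'I_k, (i <= j)%N -> (#|fiber f j| <= #|fiber f i|)%N) ->
  (l.+1%:R)^-1 < rho <= l%:R^-1 ->
  exists2 K, 0 <= K & forall n, (0 < n)%N ->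
    let g := Lambda_seq f l rho hgamma c n + hgamma n / c n in
    0 <= g <= K / n%:R /\ (l%:R * rho = 1 \/ #|fiber f l| = 0%N -> g = 0).
Proof.
move=> l0 S0pos hf hl; rewrite /Lambda_seq /=.
set S0 := fiber_sum f 0 l in S0pos *; set S1 := fiber_sum f l _.
have S0R : 0 < S0%:R :> R by rewrite ltr0n.
have ln20 := @ln2_gt0 R.
have log21 : log2 1 = 0 :> R by rewrite /log2 ln1 mul0r.
have coef0 (s : nat) : 0 <= s%:R / (expR 1 * S0%:R) :> R.
  by rewrite divr_ge0 // mulr_ge0 ?expR_ge0 // ltW.
have log2_rate (s : nat) (D : R) (x : nat -> R) :
    0 <= D -> (forall n, (0 < n)%N -> 0 <= x n <= D / n%:R) ->
    exists2 K, 0 <= K & forall n, (0 < n)%N ->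
      0 <= log2 (1 + s%:R / (expR 1 * S0%:R) * x n) <= K / n%:R.
  move=> D0 hx; exists (s%:R / (expR 1 * S0%:R) * D / ln 2).
    by rewrite divr_ge0 ?(ltW ln20) // mulr_ge0.
  move=> n n0; have /andP[x0 xD] := hx n n0.
  have /andP[-> h] := log2_1Dx_bounds _ (mulr_ge0 (coef0 s) x0).
  rewrite (le_trans h) // [leRHS]mulrAC ler_pM2r ?invr_gt0 // -[leRHS]mulrA.
  exact: ler_wpM2l.
case: (boolP (l <= k %/ 2)%N) => lk2.
  have [D D0 hmu] := mu_seq_bounds k l rho l0 lk2 hl.
  case: (boolP (S1 <= S0)%N) => S10.
    have [|K K0 hK] := log2_rate S1 D (mu_seq k l rho) D0.
      by move=> n n0; case: (hmu n n0).
    exists K => // n n0; rewrite subrK; split; first exact: hK.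
    case=> [lr1|fl0]; first by have [_ ->] := hmu n n0; rewrite // mulr0 addr0.
    by rewrite /S1 fiber_sum_eq0 // !mul0r addr0.
  have S01 : (S0 < S1)%N by rewrite ltnNge.
  have lg0 : 0 <= log2 (S1%:R / S0%:R) :> R.
    by rewrite log2_ge0 // ler_pdivlMr // mul1r ler_nat ltnW.
  exists (D * log2 (S1%:R / S0%:R)); first exact: mulr_ge0.
  move=> n n0; rewrite subrK; have [/andP[m0 mD] m1] := hmu n n0.
  split; first by rewrite mulr_ge0 //= [leRHS]mulrAC ler_wpM2r.
  case=> [lr1|fl0]; first by rewrite m1 ?mul0r.
  (* An empty [l]-th fiber would give [S1 = 0], against [S0 < S1]. *)
  by move: S01; rewrite /S1 fiber_sum_eq0.
have lrho0 : 0 < l%:R * rho.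
  case/andP: hl => h _; rewrite mulr_gt0 ?ltr0n //.
  by apply: lt_trans h; rewrite invr_gt0 ltr0n.
have [||K K0 hK] := log2_rate #|fiber f l| (l%:R * rho)^-1
    (fun n => (ceil_frac n (1 - l%:R * rho) - (1 - l%:R * rho)) / (l%:R * rho)).
- by rewrite invr_ge0 ltW.
- move=> n n0; have /andP[c1 c2] := ceil_frac_bounds n (1 - l%:R * rho) n0.
  rewrite divr_ge0 ?subr_ge0 ?(ltW lrho0) //= [leRHS]mulrC.
  by rewrite ler_pM2r ?invr_gt0 //; lra.
exists K => // n n0; rewrite subrK; split; first exact: hK.
case=> [lr1|fl0]; last by rewrite fl0 !mul0r addr0.
by rewrite lr1 subrr /ceil_frac mulr0 ceil0 mul0r subrr mul0r mulr0 addr0.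
Qed.

Lemma littleo_inv_bound (h c : nat -> R) :
  ((fun n => h n / c n : R^o) =o_\oo (fun n => n%:R^-1 : R^o)) ->
  \forall n \near \oo, `|h n / c n| <= n%:R^-1.
Proof.
move=> /eqoP /(_ 1 ltr01); apply: filterS => n.
by rewrite mul1r => /le_trans; apply; rewrite ger0_norm // invr_ge0.
Qed.

End Limits.

(** * The minimax lower bound and the limits *)

Theorem theorem5 (R : realType) (X : finType) (k : nat) (f : X -> 'I_k)
    (rho : R) (l : nat)
    (hr : (2 <= #|X|)%N)
    (hk : (2 <= k <= #|X|)%N)
    (hf : forall i j : 'I_k, (i <= j)%N -> (#|fiber f j| <= #|fiber f i|)%N)
    (hrho : k%:R^-1 < rho <= 1)
    (hl : (1 <= l <= k - 1)%N)
    (hlrho : (l.+1%:R)^-1 < rho <= l%:R^-1) :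
  omega f rho = log2 (fiber_sum f 0 l)%:R /\
  exists W : X -> 'I_k -> R,
    [/\ rho_QR f rho W,
        locally_identical f W &
        forall (k' : nat) (phi : 'I_k -> 'I_k') (gamma hgamma c : nat -> R)
               (zeta : R),
          labelled_partition phi ->
          smooth_params gamma hgamma c ->
          1 < zeta ->
          [/\ \forall n \near \oo,
                (((omega f rho + Lambda_seq f l rho hgamma c n)
                    * lambda_seq k l zeta n)%:E
                  <= smooth_minimax W phi gamma hgamma c n)%E,
              Lambda_seq f l rho hgamma c n @[n --> \oo] --> (0 : R),
              lambda_seq k l zeta n @[n --> \oo] --> (1 : R) &
              ((omega f rho)%:E
                <= limn_einf (smooth_minimax W phi gamma hgamma c))%E]].
Proof.
have X0 : (0 < #|X|)%N by exact: leq_trans hr.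
have /andP[krho rho1] := hrho; have /andP[l0 lk1] := hl.
have k1 : (0 < k)%N by case/andP: hk => h _; exact: leq_trans h.
have lk : (l < k)%N by rewrite -(subnK k1) addn1 ltnS.
have /andP[hlrho1 hlrho2] := hlrho.
have rho0 : 0 < rho by apply: lt_trans hlrho1; rewrite invr_gt0 ltr0n.
have lR0 : 0 < l%:R :> R by rewrite ltr0n.
have lrho1 : l%:R * rho <= 1 by rewrite mulrC -ler_pdivlMr // div1r.
have lrho0 : 0 < l%:R * rho by rewrite mulr_gt0.
have omegaE : omega f rho = log2 (fiber_sum f 0 l)%:R.
  by apply: omega_eq => //; rewrite l0 lk.
have S0 := fiber_sum_gt0 f hf l X0 l0.
have A0 : (0 < #|low_fibers f l|)%N by rewrite card_low_fibers.
split=> //; exists (lo_QR f rho l); split.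
- exact: lo_QR_is_rho_QR lk (ltW rho0) lrho1 rho1.
- exact: lo_QR_locally_identical.
move=> k' phi gamma hgamma c zeta _ [hpos [_ _ _] ho] zeta1.
have c0 n : (0 < n)%N -> 0 < c n by move=> n0; case: (hpos n n0).
have omega0 : 0 <= omega f rho by rewrite omegaE log2_ge0 // ler1n.
have [K K0 hK] := Lambda_seq_bounds X k f l rho hgamma c l0 S0 hf hlrho.
have [C C0 hC] := lambda_seq_bounds k l zeta zeta1.
have baseline : \forall n \near \oo, ((omega f rho)%:E <=
    smooth_minimax (lo_QR f rho l) phi gamma hgamma c n)%E.
  near=> n; have n0 : (0 < n)%N by near: n; exact: nbhs_infty_gt.
  apply: smooth_minimax_ge (c0 n n0) _ => q qpmf q0.
  by rewrite omegaE -card_low_fibers; apply: lo_QR_baseline => //; exact: ltW.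
have lambda1 : lambda_seq k l zeta n @[n --> \oo] --> (1 : R).
  apply: (cvg_of_inv_rate _ _ C); near=> n.
  have n0 : (0 < n)%N by near: n; exact: nbhs_infty_gt.
  by have /andP[h1 h2] := hC n n0; rewrite ler_norml; apply/andP; split; lra.
(* The excess is requested with the very [K] that bounds [g]. *)
have degenerate_or_excess : (l%:R * rho = 1 \/ #|fiber f l| = 0%N) \/
    \forall n \near \oo, ((omega f rho + K / n%:R)%:E <=
      smooth_minimax (lo_QR f rho l) phi gamma hgamma c n)%E.
  have [|lr1] := eqVneq (l%:R * rho) 1; first by left; left.
  have [|/card_gt0P[y]] := posnP #|fiber f l|; first by left; right.
  rewrite inE => /eqP fy; right.
  have lrho_lt1 : l%:R * rho < 1 by rewrite lt_neqAle lr1.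
  have hex := lo_QR_excess f rho l lk (ltW rho0) lrho1 y fy lrho_lt1 lrho0 K K0 A0.
  near=> n; have n0 : (0 < n)%N by near: n; exact: nbhs_infty_gt.
  apply: smooth_minimax_ge (c0 n n0) _ => q qpmf q0.
  rewrite omegaE -card_low_fibers.
  by move: q qpmf q0; near: n.
split => //; last exact: limn_einf_ge.
(* For small [n] the factor may be negative; its limit 1 makes it eventually positive. *)
- have lambda_pos : \forall n \near \oo, 0 <= lambda_seq k l zeta n.
    near=> n; apply: ltW; near: n; exact: (cvgr_gt _ lambda1 _ ltr01).
  have target n : (0 < n)%N -> 0 <= lambda_seq k l zeta n ->
      let g := Lambda_seq f l rho hgamma c n + hgamma n / c n in
      (omega f rho + Lambda_seq f l rho hgamma c n) * lambda_seq k l zeta n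
        <= omega f rho + g.
    move=> n0 lam0 /=; have [_ h2 h3] := hpos n n0.
    have /andP[g0 _] := (hK n n0).1; have /andP[_ lam1] := hC n n0.
    have hc0 : 0 <= hgamma n / c n by rewrite divr_ge0 // ltW.
    (* The smoothness term can make the sum negative, and then the product is at most 0; otherwise a
       factor at most 1 only lowers it. *)
    have [neg|pos] := ltP (omega f rho + Lambda_seq f l rho hgamma c n) 0.
      by apply: (@le_trans _ _ 0); [rewrite mulr_le0_ge0 // ltW | exact: addr_ge0].
    apply: (@le_trans _ _ (omega f rho + Lambda_seq f l rho hgamma c n)).
      by rewrite ler_piMr.
    by rewrite addrA lerDl.
  case: degenerate_or_excess => [deg|excess]; near=> n.
  + have n0 : (0 < n)%N by near: n; exact: nbhs_infty_gt.
    apply: (@le_trans _ _ (omega f rho)%:E); last by near: n.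
    have lam0 : 0 <= lambda_seq k l zeta n by near: n.
    by have := target n n0 lam0; rewrite /= ((hK n n0).2 deg) addr0 lee_fin.
  + have n0 : (0 < n)%N by near: n; exact: nbhs_infty_gt.
    apply: (@le_trans _ _ (omega f rho + K / n%:R)%:E); last by near: n.
    have lam0 : 0 <= lambda_seq k l zeta n by near: n.
    rewrite lee_fin (le_trans (target n n0 lam0)) //= lerD2l.
    by case/andP: (hK n n0).1.
(* [K / n] bounds [g], and the little-o hypothesis with constant 1 bounds the smoothness term by
   [1 / n]. *)
- apply: (cvg_of_inv_rate _ _ (K + 1)); near=> n.
  have n0 : (0 < n)%N by near: n; exact: nbhs_infty_gt.
  have /andP[g0 gK] := (hK n n0).1.
  have : `|hgamma n / c n| <= n%:R^-1 by near: n; exact: littleo_inv_bound.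
  rewrite ler_norml subr0 ler_norml mulrDl mul1r => /andP[h1 h2].
  have Kn : 0 <= K / n%:R by rewrite divr_ge0.
  by apply/andP; split; lra.
Unshelve. all: by end_near.
Qed.
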